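(* Let $(X,d)$ be a metric space and let $n\ge 0$ be an integer. Then the following conditions are equivalent: (a) $\mathrm{asdim}(X,d)\le n$. (b) For all $R>0$ and $\epsilon>0$ there exist $S>0$ and finite non-empty subsets $A_x\subset B(x,S)\times \mathbb{N}$, one for each $x\in X$, such that $$\frac{|A_x\Delta A_y|}{|A_x\cap A_y|}<\epsilon\quad\text{for all } x,y\in X \text{ with } d(x,y)<R,$$ and for every $x\in X$ the projection of $A_x$ onto $X$ contains at most $n+1$ elements. (c) For every $R>0$ there exist $S>0$ and finite non-empty subsets $A_x\subset B(x,S)\times \mathbb{N}$, one for each $x\in X$, such that $$\frac{|A_x\Delta A_y|}{|A_x\cap A_y|}<\frac{1}{n+1}\quad\text{for all } x,y\in X \text{ with } d(x,y)<R,$$ and for every $x\in X$ the projection of $A_x$ onto $X$ contains at most $n+1$ elements.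
   Context: Here $\mathbb{N}$ is the set of natural numbers, $B(x,S)$ is the ball in $X$ of radius $S$ centered at $x$, $A\Delta B$ denotes the symmetric difference of sets, and $|A|$ denotes the cardinality of $A$. An inequality $\frac{|A_x\Delta A_y|}{|A_x\cap A_y|}<c$ is understood to include the requirement that $A_x\cap A_y\neq\emptyset$ (so that the quotient is defined). The projection of $A_x$ onto $X$ is its image under $X\times\mathbb{N}\to X$, $(y,m)\mapsto y$. Asymptotic dimension: a metric space $X$ has finite asymptotic dimension if there is an integer $k\ge 0$ such that for every $L>0$ there is a cover $\mathcal{U}$ of $X$ that is (i) uniformly bounded: there is $S>0$ such that every element of $\mathcal{U}$ has diameter at most $S$; (ii) of Lebesgue number at least $L$: every ball $B(x,L)$, $x\in X$, is contained in some element of $\mathcal{U}$; and (iii) of multiplicity at most $k+1$: each point of $X$ belongs to at most $k+1$ elements of $\mathcal{U}$. The least such $k$ is the asymptotic dimension $\mathrm{asdim}(X,d)$. Thus $\mathrm{asdim}(X,d)\le n$ means that for some $k\le n$ (equivalently, for $k=n$) it holds that for every $L>0$ there is a uniformly bounded cover of $X$ of Lebesgue number at least $L$ and multiplicity at most $k+1$. *)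

(* Defs.v *)
From HB Require Import structures.
From mathcomp Require Import all_boot all_order all_algebra finmap.
From mathcomp Require Import all_classical all_reals all_analysis.

Set Implicit Arguments.
Unset Strict Implicit.
Unset Printing Implicit Defensive.

Import Order.TTheory GRing.Theory Num.Theory.

Local Open Scope classical_set_scope.
Local Open Scope card_scope.
Local Open Scope ring_scope.

Definition is_cover (T : Type) (U : set (set T)) : Prop :=
  forall x, exists2 V, U V & V x.

(* Every member has diameter at most S: this is phrased on pairs of points, so
   that the empty set is allowed as a member. *)
Definition uniformly_bounded (R : realType) (X : metricType R)
    (U : set (set X)) : Prop :=
  exists2 S : R, 0 < S & forall V, U V -> forall x y, V x -> V y -> mdist x y <= S.

Definition lebesgue_number_ge (R : realType) (X : metricType R)
    (U : set (set X)) (L : R) : Prop :=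
  forall x : X, exists2 V, U V & ball x L `<=` V.

Definition multiplicity_le (T : Type) (U : set (set T)) (m : nat) : Prop :=
  forall x, [set V | U V /\ V x] #<= `I_m.

Definition asdim_bound (R : realType) (X : metricType R) (k : nat) : Prop :=
  forall L : R, 0 < L -> exists U : set (set X),
    [/\ is_cover U, uniformly_bounded U, lebesgue_number_ge U L
      & multiplicity_le U k.+1].

(* The least k such that asdim_bound X k, as an extended real; it is +oo when
   there is no such k, since ereal_inf set0 = +oo. *)
Definition asdim (R : realType) (X : metricType R) : \bar R :=
  ereal_inf [set (k%:R)%:E | k in asdim_bound X].

Definition fsymdiff (T : choiceType) (A B : {fset T}) : {fset T} :=
  ((A `\` B) `|` (B `\` A))%fset.

(* The inequality |A symdiff B| / |A cap B| < c; nonemptiness of the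
   intersection is required explicitly because x / 0 = 0 in a fieldType. *)
Definition symdiff_ratio_lt (R : realType) (T : choiceType)
    (A B : {fset T}) (c : R) : Prop :=
  (A `&` B)%fset != fset0 /\
  #|` fsymdiff A B|%:R / #|` (A `&` B)%fset|%:R < c.

Definition fproj1 (T T' : choiceType) (A : {fset T * T'}) : {fset T} :=
  [fset p.1 | p in A]%fset.

(* Main.v *)
Require Import Defs.
From mathcomp Require Import all_boot all_order all_algebra finmap.
From mathcomp Require Import all_classical all_reals all_analysis.

(* (a) => (b): take a cover U of Lebesgue number at least L = N r and choose a
   point c V in each member V.  Let A_x consist of the pairs (c V, k) with k < N
   and B(x, (k + 1) r) included in V.  Over each point the set A_x is an initial
   segment of N, and a move by less than r changes its length by at most 1, so
   |A_x symdiff A_y| <= 2 (n + 1), whereas A_x cap A_y contains the N - 1 lower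
   pairs over c V for any V containing B(x, L).
   (c) => (a): the sets V_p = {x | p in the projection of A_x} form the required
   cover.  If p carries the largest fibre of A_x, of size at least
   |A_x| / (n + 1), then B(x, L) is included in V_p, as otherwise for some y in
   the ball that whole fibre would lie in A_x \ A_y. *)

Set Implicit Arguments.
Unset Strict Implicit.
Unset Printing Implicit Defensive.

Import Order.TTheory GRing.Theory Num.Theory.

Local Open Scope classical_set_scope.
Local Open Scope ring_scope.

Lemma multiplicity_leW (T : Type) (U : set (set T)) (k m : nat) :
  (k <= m)%N -> multiplicity_le U k -> multiplicity_le U m.
Proof. by move=> km Uk x; rewrite (card_le_trans (Uk x))// card_le_II. Qed.

(** Relaxing the bound on the infimum to the strict [asdim X < n.+1] yields an admissible natural
    number [k < n.+1], hence [k <= n]. *)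
Lemma asdim_leP (R : realType) (X : metricType R) (n : nat) :
  (asdim X <= n%:R%:E)%E <-> asdim_bound X n.
Proof.
split=> [|Xn]; last by apply: ereal_inf_lbound; exists n.
move=> asn; have : (asdim X < n.+1%:R%:E)%E.
  by rewrite (le_lt_trans asn)// lte_fin ltr_nat.
move=> /ereal_inf_lt[_ [k Xk <-]]; rewrite lte_fin ltr_nat ltnS => kn L L0.
have [U [covU bU LU mU]] := Xk L L0; exists U; split=> //.
exact: multiplicity_leW mU.
Qed.

(** The fibres over [fproj1 A] partition [A], and [p] is chosen to carry the largest one. *)
Lemma card_fproj1_pigeonhole {T T' : choiceType} (A : {fset T * T'}) :
  A != fset0 -> exists2 p, p \in fproj1 A &
    (#|` A| <= #|` fproj1 A| * #|` [fset q in A | q.1 == p]%fset|)%N.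
Proof.
move=> /fset0Pn[q0 q0A].
have p0A : q0.1 \in fproj1 A by apply/imfsetP; exists q0.
pose F p := #|` [fset q in A | q.1 == p]%fset|.
case: (@arg_maxnP _ [` p0A]%fset predT (fun p => F (val p))) => //= p _ pmax.
exists (val p); first exact: valP.
have -> : #|` A| = (\sum_(p <- fproj1 A) F p)%N.
  rewrite card_fset_sum1 (partition_big_imfset _ fst)/=.
  apply: eq_big_seq => p' _; rewrite /F card_fset_sum1.
  by rewrite [RHS]big_fset.
rewrite card_fset_sum1 big_distrl/= big_seq [leqRHS]big_seq.
apply: leq_sum => p' p'A; rewrite mul1n.
exact: (pmax [` p'A]%fset).
Qed.

(** Over each point at most one pair survives in the difference: if [(p, k)] and [(p, l)] did with
    [k < l], then [(p, l - 1)] would be in [B], and so would [(p, k)] below it. Hence [fst] is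
    injective there. *)
Lemma card_fsetD_staircase {T : choiceType} (A B : {fset T * nat}) :
  (forall p k, (p, k.+1) \in A -> (p, k) \in B) ->
  (forall p k, (p, k.+1) \in B -> (p, k) \in B) ->
  (#|` (A `\` B)%fset| <= #|` fproj1 A|)%N.
Proof.
move=> AB BB.
have Bdown p k j : (j <= k)%N -> (p, k) \in B -> (p, j) \in B.
  move=> jk; rewrite -(subnK jk); elim: (k - j)%N => //= m IH.
  by rewrite addSn => /BB.
have AB_le p k l : (p, k) \in (A `\` B)%fset -> (p, l) \in (A `\` B)%fset ->
    (l <= k)%N.
  rewrite !inE => /andP[kB _] /andP[_ lA]; rewrite leqNgt; apply/negP => kl.
  case: l kl lA => // l kl /AB lB.
  by rewrite (Bdown _ _ _ _ lB) in kB.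
have fst_inj : {in (A `\` B)%fset &, injective fst}.
  move=> [p k] [q l] /= pkAB + pq; rewrite -{}pq => plAB.
  by congr pair; apply/eqP; rewrite eqn_leq !(AB_le p).
have <- : #|` fproj1 (A `\` B)%fset| = #|` (A `\` B)%fset|.
  exact: card_in_imfset.
apply: fsubset_leq_card; apply/fsubsetP => _ /imfsetP[q /= qAB ->].
by apply/imfsetP; exists q => //; move: qAB; rewrite inE => /andP[].
Qed.

Lemma ball_mdist_center (R : realType) (X : metricType R) (x : X) (r : R) :
  0 < r -> ball x r x.
Proof. by move=> r0; rewrite ballEmdist/= mdistxx. Qed.

Lemma ball_mdist_subset (R : realType) (X : metricType R) (x y : X) (e r : R) :
  mdist x y < r -> ball y e `<=` ball x (e + r).
Proof.
move=> xy z; rewrite !ballEmdist/= => yz.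
by rewrite (le_lt_trans (metric_triangle x y z))// addrC ltrD.
Qed.

Section cover_staircase.
Variables (R : realType) (X : metricType R).
Variables (U : set (set X)) (c : set X -> X) (r : R) (N : nat).

(* Different members V may share the same point c V: this only merges initial
   segments over that point. *)
Definition cover_staircase (x : X) : set (X * nat) :=
  [set q | (q.2 < N)%N /\
    exists V, [/\ U V, c V = q.1 & ball x (q.2.+1%:R * r) `<=` V]].

Hypothesis r0 : 0 < r.

(** Every ball around [x] contains [x], so only members through [x] contribute. The multiplicity of
    [U] thus bounds the projection. *)
Lemma cover_staircase_fst (x : X) :
  fst @` cover_staircase x `<=` c @` [set V | U V /\ V x].
Proof.
move=> _ [q [_ [V [UV cV xV]]] <-]; exists V => //; split=> //; apply: xV.
by apply: ball_mdist_center; rewrite mulr_gt0.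
Qed.

Lemma finite_cover_staircase (m : nat) (x : X) :
  multiplicity_le U m -> finite_set (cover_staircase x).
Proof.
move=> Um; apply: (@sub_finite_set _ _
    ((c @` [set V | U V /\ V x]) `*` `I_N)).
  move=> q qx; split; last by case: qx.
  by apply: cover_staircase_fst; exists q.
apply: finite_setX; last exact: finite_II.
by apply: finite_image; apply/finite_set_leP; exists m; exact: Um.
Qed.

Lemma card_fproj1_cover_staircase (m : nat) (x : X) :
  multiplicity_le U m ->
  (#|` fproj1 (fset_set (cover_staircase x))| <= m)%N.
Proof.
move=> Um; have finx := finite_cover_staircase x Um.
rewrite /fproj1 -fset_set_image//; apply: geq_card_fset_set.
rewrite (card_le_trans (subset_card_le (@cover_staircase_fst x)))//.
by rewrite (card_le_trans (card_image_le _ _))//; exact: Um.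
Qed.

Lemma cover_staircase_pred (x y : X) (p : X) (k : nat) : mdist x y < r ->
  cover_staircase x (p, k.+1) -> cover_staircase y (p, k).
Proof.
move=> xy [/= kN [V [UV cV xV]]]; split; first exact: ltnW.
exists V; split=> //=; apply: subset_trans xV.
rewrite [k.+2%:R]mulrSr mulrDl mul1r.
exact: ball_mdist_subset.
Qed.

End cover_staircase.

Lemma asdim_bound_staircase (R : realType) (X : metricType R) (n : nat) :
  asdim_bound X n -> forall r eps : R, 0 < r -> 0 < eps ->
  exists (S : R) (A : X -> {fset X * nat}),
    [/\ 0 < S,
        forall x, A x != fset0 /\ (forall p, p \in A x -> ball x S p.1),
        forall x y, mdist x y < r -> symdiff_ratio_lt (A x) (A y) eps
      & forall x, (#|` fproj1 (A x)| <= n.+1)%N].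
Proof.
move=> Xn r eps r0 eps0.
have [x0|noX] := pselect (exists x0 : X, True); last first.
  by exists 1, (fun=> fset0); split=> // x; case: noX; exists x.
case: x0 => x0 _.
(* The staircases get [M.+1] levels. A move by less than [r] may lose the top one, so [M] common
   levels remain, enough to make the ratio less than [eps]. *)
have [M ltM] : exists M : nat, (n.+1 + n.+1)%:R / eps < M%:R.
  by eexists; apply: archi_boundP; rewrite divr_ge0// ltW.
have M0 : (0 < M)%N.
  by rewrite -(ltr_nat R) (le_lt_trans _ ltM)// divr_ge0// ltW.
have L0 : 0 < M.+1%:R * r by rewrite mulr_gt0.
have [U [_ [D D0 bU] LU mU]] := Xn _ L0.
(* The default [x0] is taken only on an empty [V]; a member contributing to [A x] contains [x]. *)
pose c (V : set X) := xget x0 V.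
pose A x := fset_set (cover_staircase U c r M.+1 x).
have finA x : finite_set (cover_staircase U c r M.+1 x).
  exact: finite_cover_staircase mU.
have inA x q : (q \in A x) = (q \in cover_staircase U c r M.+1 x).
  by rewrite in_fset_set.
have ball_c (x : X) k V : ball x (k.+1%:R * r) `<=` V -> V x.
  by apply; apply: ball_mdist_center; rewrite mulr_gt0.
have Apred x y p k : mdist x y < r -> (p, k.+1) \in A x -> (p, k) \in A y.
  by rewrite !inA !inE; exact: cover_staircase_pred.
have Aself x p k : (p, k.+1) \in A x -> (p, k) \in A x.
  by apply: Apred; rewrite mdistxx.
have Afull x : exists p, forall k, (k < M.+1)%N -> (p, k) \in A x.
  have [V UV xV] := LU x; exists (c V) => k kM; rewrite inA inE; split=> //=.
  exists V; split=> //; apply: subset_trans xV; apply: le_ball.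
  by rewrite ler_pM2r// ler_nat.
have Aproj x : (#|` fproj1 (A x)| <= n.+1)%N.
  exact: card_fproj1_cover_staircase.
(* The diameter bound [D] is not strict while balls are open, hence the extra 1. *)
exists (D + 1), A; split=> //; first by rewrite addr_gt0.
  move=> x; split.
    by have [p /(_ 0%N isT) pA] := Afull x; apply/fset0Pn; exists (p, 0%N).
  move=> [p k]; rewrite inA inE => -[_ /= [V [UV <- xV]]].
  have Vx := ball_c _ _ _ xV; rewrite ballEmdist/=.
  rewrite (@le_lt_trans _ _ D) ?ltrDl//; apply: (bU V) => //.
  exact: xgetPex (ex_intro _ x Vx).
move=> x y xy.
have yx : mdist y x < r by rewrite metric_sym.
(* For [k < M], the pair [(p, k.+1)] of the full column over [p] is still in [A x], so [(p, k)] lies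
   in [A y]. *)
have capM : (M <= #|` (A x `&` A y)%fset|)%N.
  have [p pA] := Afull x.
  have -> : M = #|` [fset (p, val k) | k in 'I_M]%fset|.
    by rewrite card_imfset ?size_enum_ord// => i j [] /val_inj.
  apply: fsubset_leq_card; apply/fsubsetP => _ /imfsetP[k _ ->].
  by rewrite in_fsetI pA ?ltnS ?(ltnW (ltn_ord k))//= (Apred x)// pA// ltnS.
split; first by rewrite -cardfs_gt0 (leq_trans M0).
rewrite ltr_pdivrMr ?ltr0n ?(leq_trans M0)//.
rewrite ltr_pdivrMr// mulrC in ltM.
apply: (@le_lt_trans _ _ (n.+1 + n.+1)%:R).
  rewrite ler_nat (leq_trans (leq_card_fsetU _ _))//.
  by rewrite leq_add// (leq_trans (card_fsetD_staircase _ _))// => p k;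
    solve [exact: Apred|exact: Aself].
by rewrite (lt_le_trans ltM)// ler_pM2l// ler_nat.
Qed.

Lemma asdim_bound_of_fset (R : realType) (X : metricType R) (n : nat) :
  (forall r : R, 0 < r -> exists (S : R) (A : X -> {fset X * nat}),
    [/\ 0 < S,
        forall x, A x != fset0 /\ (forall p, p \in A x -> ball x S p.1),
        forall x y, mdist x y < r ->
          symdiff_ratio_lt (A x) (A y) (1 / n.+1%:R : R)
      & forall x, (#|` fproj1 (A x)| <= n.+1)%N]) ->
  asdim_bound X n.
Proof.
move=> H L L0; have [S [A [S0 A0 Ady Aproj]]] := H L L0.
pose V p := [set x | p \in fproj1 (A x)].
have VS p x : V p x -> mdist x p < S.
  move=> /imfsetP[q /= qA ->]; have [_ /(_ _ qA)] := A0 x.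
  by rewrite ballEmdist.
have LU x : exists p, ball x L `<=` V p.
  have [Ax0 _] := A0 x.
  have [p _ pcard] := card_fproj1_pigeonhole Ax0; exists p => y.
  (* By contraposition: if [p] is missed by [A y], the symmetric difference contains the fibre of
     [A x] over [p]. With [n.+1] times that fibre at least the size of [A x], hence of the
     intersection, the ratio is at least [1 / n.+1]. *)
  rewrite ballEmdist/= => /Ady[cap0]; rewrite /V/=; apply: contraPT => pAy.
  apply/negP; rewrite -leNgt ler_pdivlMr ?ltr0n ?cardfs_gt0//.
  rewrite mul1r mulrC ler_pdivrMr// -natrM ler_nat.
  have fibre_sub : ([fset q in A x | q.1 == p] `<=` fsymdiff (A x) (A y))%fset.
    apply/fsubsetP => q; rewrite !inE => /andP[qA /eqP qp].
    rewrite qA andbT; apply/orP; left; apply: contra pAy => qAy.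
    by apply/imfsetP; exists q.
  rewrite (leq_trans (fsubset_leq_card (fsubsetIl _ _)))//.
  rewrite (leq_trans pcard)// mulnC leq_mul//.
  exact: fsubset_leq_card.
exists (range V); split.
- by move=> x; have [p xV] := LU x; exists (V p); [exists p|
    exact/xV/ball_mdist_center].
- exists (S + S); first by rewrite addr_gt0.
  move=> _ [p _ <-] x y /VS xp /VS yp.
  by rewrite ltW// (le_lt_trans (metric_triangle x p y))// ltrD// metric_sym.
- by move=> x; have [p xV] := LU x; exists (V p) => //; exists p.
(* Members are counted as sets: distinct [p] with equal [V p] only lower the count. *)
- move=> x; have sub : [set W | range V W /\ W x] `<=` V @` [set` fproj1 (A x)].
    by move=> _ [[p _ <-] Vpx]; exists p.
  rewrite (card_le_trans (subset_card_le sub))//.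
  rewrite (card_le_trans (card_image_le _ _))//.
  have /card_eq_fsetP := erefl #|` fproj1 (A x)|.
  by move=> /card_eqPle[+ _] => /card_le_trans; apply; rewrite card_le_II.
Qed.

Theorem theorem2p1 (R : realType) (X : metricType R) (n : nat) :
  [<->
    (* (a) *)
    (asdim X <= (n%:R)%:E)%E;
    (* (b) *)
    forall r eps : R, 0 < r -> 0 < eps ->
      exists (S : R) (A : X -> {fset X * nat}),
        [/\ 0 < S,
            forall x, A x != fset0 /\
              (forall p, p \in A x -> ball x S p.1),
            forall x y, mdist x y < r -> symdiff_ratio_lt (A x) (A y) eps
          & forall x, (#|` fproj1 (A x)| <= n.+1)%N];
    (* (c) *)
    forall r : R, 0 < r ->
      exists (S : R) (A : X -> {fset X * nat}),
        [/\ 0 < S,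
            forall x, A x != fset0 /\
              (forall p, p \in A x -> ball x S p.1),
            forall x y, mdist x y < r ->
              symdiff_ratio_lt (A x) (A y) (1 / n.+1%:R : R)
          & forall x, (#|` fproj1 (A x)| <= n.+1)%N]
  ].
Proof.
tfae.
- by move=> /asdim_leP; exact: asdim_bound_staircase.
- by move=> H r r0; apply: H => //; rewrite divr_gt0.
- by move=> H; apply/asdim_leP; exact: asdim_bound_of_fset.
Qed.
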